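(* Let $n\ge2$, $\lambda_i,\lambda_i'\in\mathbb{C}^*$ for $1\le i\le n$, and $a,a'\in-\frac{1}{n+1}\mathbb{Z}_+$. Then $W_{1-a}(\lambda_1,\dots,\lambda_n)\cong W_{1-a'}(\lambda_1',\dots,\lambda_n')$ as $\mathfrak{sl}_{n+1}(\mathbb{C})$-modules if and only if $a=a'$ and $\lambda_i=\lambda_i'$ for all $1\le i\le n$.
   Context: $\mathbb{Z}_+$ denotes the non-negative integers. Let $\partial_i=t_i\frac{\partial}{\partial t_i}$ ($1\le i\le n$) on $\mathbb{C}[t_1^{\pm1},\dots,t_n^{\pm1}]$; for $u\in\mathbb{C}^n$, $j\in\mathbb{Z}^n$ put $D(u,j)=t_1^{j_1}\cdots t_n^{j_n}\sum_i u_i\partial_i$ and $(u|j)=\sum_i u_ij_i$. The Witt algebra $\mathcal{W}_n$ is the Lie algebra of derivations of $\mathbb{C}[t_1^{\pm1},\dots,t_n^{\pm1}]$, spanned by all $D(u,j)$. Embedding of $\mathfrak{sl}_{n+1}(\mathbb{C})$ in $\mathcal{W}_n$: put $e_{ij}=t_it_j^{-1}\partial_j$ ($1\le i,j\le n$), $e_{i,n+1}=-t_i\sum_{j=1}^n\partial_j$, $e_{n+1,i}=t_i^{-1}\partial_i$ ($1\le i\le n$), $e_{n+1,n+1}=-\sum_{j=1}^n\partial_j$. Then $\{e_{ij}:1\le i\ne j\le n+1\}\cup\{e_{ii}-e_{i+1,i+1}:1\le i\le n\}$ is the standard basis of $\mathfrak{sl}_{n+1}(\mathbb{C})\subset\mathcal{W}_n$.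 The module $\Omega_{1-a}(\lambda_1,\dots,\lambda_n)$ ($a\in\mathbb{C}$, $\lambda_i\in\mathbb{C}^*$): its underlying space is the polynomial algebra $\mathbb{C}[\partial_1,\dots,\partial_n]$ in commuting indeterminates, with $\mathcal{W}_n$ acting by $$D(u,j)\circ f(\partial_1,\dots,\partial_n)=\lambda_1^{j_1}\cdots\lambda_n^{j_n}\Big(\sum_{i=1}^nu_i\partial_i-a(u|j)\Big)f(\partial_1-j_1,\dots,\partial_n-j_n),$$ and it is regarded as an $\mathfrak{sl}_{n+1}(\mathbb{C})$-module by restriction. For $a=-\frac{m}{n+1}$ with $m\in\mathbb{Z}_+$: set $Y_0^i=1$ and $Y_j^i=(\partial_i+a)(\partial_i+a+1)\cdots(\partial_i+a+j-1)$ for $1\le i\le n$, $j\ge1$; for $j_1,\dots,j_n\in\mathbb{Z}_+$ with $j_1+\cdots+j_n=m+1$ set $Y(j_1,\dots,j_n)=Y_{j_1}^1Y_{j_2}^2\cdots Y_{j_n}^n$; and $$W_{1-a}(\lambda_1,\dots,\lambda_n)=\sum_{j_1,\dots,j_n\in\mathbb{Z}_+,\ j_1+\cdots+j_n=m+1}\mathbb{C}[\partial_1,\dots,\partial_n]\,Y(j_1,\dots,j_n)\subseteq\Omega_{1-a}(\lambda_1,\dots,\lambda_n).$$ This subspace is an $\mathfrak{sl}_{n+1}(\mathbb{C})$-submodule of $\Omega_{1-a}(\lambda_1,\dots,\lambda_n)$, and is regarded as an $\mathfrak{sl}_{n+1}(\mathbb{C})$-module in this way. *)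

(* Defs.v *)
(* MathComp, with the multinomials library for {mpoly F[n]} and {freeg K / F}. *)
From mathcomp Require Import all_boot all_order all_algebra.
From mathcomp Require Import classical_sets functions.
From mathcomp Require Import freeg mpoly.
From mathcomp Require Import ring.

Set Implicit Arguments.
Unset Strict Implicit.
Unset Printing Implicit Defensive.

Import GRing.Theory.
Local Open Scope ring_scope.

Section Witt.
Variables (F : fieldType) (n : nat).

(* The Witt algebra W_n over F, with F-basis the derivations
   t^j \partial_i = t_1^{j_1} ... t_n^{j_n} t_i (d/dt_i) of the Laurent
   polynomial algebra; the basis vector << (j, i) >> stands for
   t^j \partial_i. *)
Definition witt := {freeg ('rV[int]_n * 'I_n)%type / F}.

Definition pairing (u : 'rV[F]_n) (j : 'rV[int]_n) : F :=
  \sum_i u 0 i * (j 0 i)%:~R.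

Definition D (u : 'rV[F]_n) (j : 'rV[int]_n) : witt :=
  \sum_i u 0 i *: << (j, i) >>.

(* Bilinear extension of
   [t^i \partial_k, t^j \partial_l]
     = j_k t^{i+j} \partial_l - i_l t^{i+j} \partial_k,
   the commutator of derivations. *)
Definition witt_bracket (X Y : witt) : witt :=
  fglift (fun p : 'rV[int]_n * 'I_n =>
    fglift (fun q : 'rV[int]_n * 'I_n =>
      (q.1 0 p.2)%:~R *: << (p.1 + q.1, q.2) >>
      - (p.1 0 q.2)%:~R *: << (p.1 + q.1, p.2) >> : witt) Y) X.

Definition tuniti (i : 'I_n) : 'rV[int]_n := delta_mx 0 i.

(* The largest index ord_max : 'I_n.+1 plays the role of n + 1, and
   [unlift ord_max i] is [None] exactly when i = ord_max. *)
Definition sl_e (i j : 'I_n.+1) : witt :=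
  match unlift ord_max i, unlift ord_max j with
  | Some i', Some j' => D (delta_mx 0 j') (tuniti i' - tuniti j')
  | Some i', None => - \sum_(k < n) D (delta_mx 0 k) (tuniti i')
  | None, Some j' => D (delta_mx 0 j') (- tuniti j')
  | None, None => - \sum_(k < n) D (delta_mx 0 k) 0
  end.

(* sl_{n+1} is the space of trace-zero matrices; the elementary matrix
   E_{ij} goes to e_{ij}. On gl_{n+1} the map has kernel the scalar matrices;
   it is a Lie algebra morphism by sl_embed_bracket below. *)
Definition sl_embed (x : 'M[F]_n.+1) : witt :=
  \sum_i \sum_j x i j *: sl_e i j.

(* The polynomial algebra F[\partial_1, ..., \partial_n]. *)
Notation Pn := {mpoly F[n]}.

Definition shift (j : 'rV[int]_n) (f : Pn) : Pn :=
  f \mPo [tuple 'X_i - ((j 0 i)%:~R)%:MP | i < n].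

Definition Omega_D (a : F) (lam : 'I_n -> F)
    (u : 'rV[F]_n) (j : 'rV[int]_n) (f : Pn) : Pn :=
  (\prod_i lam i ^ (j 0 i))
    *: ((\sum_i u 0 i *: 'X_i - (a * pairing u j)%:MP) * shift j f).

(* Omega_{1-a}(lam): linear extension of Omega_D to W_n (see Omega_actD). *)
Definition Omega_act (a : F) (lam : 'I_n -> F) (X : witt) (f : Pn) : Pn :=
  fglift (fun p : 'rV[int]_n * 'I_n =>
            Omega_D a lam (delta_mx 0 p.2) p.1 f) X.

Definition Omega_sl (a : F) (lam : 'I_n -> F) (x : 'M[F]_n.+1) (f : Pn) : Pn :=
  Omega_act a lam (sl_embed x) f.

Definition Yfac (a : F) (i : 'I_n) (j : nat) : Pn :=
  \prod_(k < j) ('X_i + (a + k%:R)%:MP).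

Definition Y (a : F) (j : 'X_{1..n}) : Pn := \prod_i Yfac a i (j i).

(* The index type 'X_{1..n < m.+2} contains every exponent vector of total
   degree m + 1, so it only serves to make the sum finite. The underlying
   space does not depend on lam; only the action does. *)
Definition W (a : F) (m : nat) : set Pn :=
  [set f | exists g : 'X_{1..n < m.+2} -> Pn,
     f = \sum_(j : 'X_{1..n < m.+2} | mdeg j == m.+1) g j * Y a j].

End Witt.

(* Isomorphism of sl_{n+1}-modules between subspaces W1, W2 that are stable
   under the respective actions; phi is only relevant on W1. *)
Definition sl_iso (F : fieldType) (n : nat) (V1 V2 : lmodType F)
    (act1 : 'M[F]_n.+1 -> V1 -> V1) (W1 : set V1)
    (act2 : 'M[F]_n.+1 -> V2 -> V2) (W2 : set V2) : Prop :=
  exists phi : V1 -> V2,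
    [/\ set_bij W1 W2 phi,
        forall (c : F) (f g : V1), W1 f -> W1 g ->
          phi (c *: f + g) = c *: phi f + phi g
      & forall (x : 'M[F]_n.+1) (f : V1), \tr x = 0 -> W1 f ->
          phi (act1 x f) = act2 x (phi f)].

(* Well-definedness of the modules: sl_embed is a Lie algebra morphism,
   Omega_{1-a}(lam) is a module over W_n, and W is stable under sl_{n+1}
   when a = - m / (n + 1). *)
Section Facts.
Variables (F : fieldType) (n : nat).
Notation Pn := {mpoly F[n]}.
Notation K := ('rV[int]_n * 'I_n)%type.
Implicit Types (u v : 'rV[F]_n) (i j : 'rV[int]_n) (f g : Pn).

Lemma fgliftD (M : lmodType F) (h : K -> M) (X Z : witt F n) :
  fglift h (X + Z) = fglift h X + fglift h Z.
Proof.
have := lift_is_additive h X (- Z); rewrite opprK => ->; congr (_ + _).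
have := lift_is_additive h 0 Z; rewrite sub0r => ->.
have := lift_is_additive h 0 0; rewrite !subrr => ->.
by rewrite sub0r opprK.
Qed.

Lemma fglift0 (M : lmodType F) (h : K -> M) : fglift h (0 : witt F n) = 0.
Proof. by have := lift_is_additive h 0 0; rewrite !subrr. Qed.

Lemma fglift_sum (M : lmodType F) (h : K -> M) (I : Type) (r : seq I) P
    (G : I -> witt F n) :
  fglift h (\sum_(k <- r | P k) G k) = \sum_(k <- r | P k) fglift h (G k).
Proof.
exact: (big_morph (fglift h) (fgliftD h) (fglift0 h)).
Qed.

Lemma fgliftZ (M : lmodType F) (h : K -> M) c (X : witt F n) :
  fglift h (c *: X) = c *: fglift h X.
Proof.
rewrite -[X in RHS]freeg_sumE fglift_sum scaler_sumr.
rewrite [c *: X]/(fgscale c X) /fgscale fglift_sum.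
by apply: eq_bigr => k _; rewrite !liftU scalerA.
Qed.

Lemma fgliftN (M : lmodType F) (h : K -> M) (X : witt F n) :
  fglift h (- X) = - fglift h X.
Proof. by rewrite -[- X]scaleN1r fgliftZ scaleN1r. Qed.

Lemma fglift_D (M : lmodType F) (h : K -> M) u j :
  fglift h (D u j) = \sum_k u 0 k *: h (j, k).
Proof.
rewrite fglift_sum; apply: eq_bigr => k _.
by rewrite fgliftZ liftU scale1r.
Qed.

Lemma witt_sumD (X : witt F n) :
  X = \sum_(p <- dom X) D (coeff p X *: delta_mx 0 p.2) p.1.
Proof.
rewrite -[LHS]freeg_sumE; apply: eq_bigr => -[j i] _ /=.
rewrite /D (bigD1 i) //= big1 ?addr0 => [|k ki].
  rewrite !mxE !eqxx mulr1; apply/eqP/freeg_eqP => x.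
  by rewrite coeffZ !coeffU mul1r.
by rewrite !mxE (negPf ki) andbF mulr0 scale0r.
Qed.

Lemma DB c d u v j : D (c *: u - d *: v) j = c *: D u j - d *: D v j.
Proof.
rewrite /D !scaler_sumr -sumrB; apply: eq_bigr => k _ /=.
by rewrite !mxE scalerBl !scalerA.
Qed.

Lemma witt_bracket_D u i v j :
  witt_bracket (D u i) (D v j)
  = D (pairing u j *: v - pairing v i *: u) (i + j).
Proof.
rewrite DB /witt_bracket fglift_D /pairing /D.
under eq_bigr => k _ do rewrite fglift_D /=.
rewrite !scaler_suml; under [X in _ = _ - X]eq_bigr do rewrite scaler_sumr.
rewrite [X in _ = _ - X]exchange_big -sumrB; apply: eq_bigr => k _ /=.
rewrite !scaler_sumr -sumrB; apply: eq_bigr => l _.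
rewrite !(scalerBr, scalerA).
congr (_ *: _ - _ *: _); first by rewrite mulrAC.
by rewrite [RHS]mulrC mulrA.
Qed.

Lemma shift_is_linear j c f g : shift j (c *: f + g) = c *: shift j f + shift j g.
Proof. by rewrite /shift comp_mpolyD comp_mpolyZ. Qed.

Lemma shiftM j f g : shift j (f * g) = shift j f * shift j g.
Proof. exact: rmorphM. Qed.

Lemma shiftX j k : shift j ('X_k : Pn) = 'X_k - ((j 0 k)%:~R)%:MP.
Proof. by rewrite /shift comp_mpolyXU -tnth_nth tnth_mktuple. Qed.

Lemma shiftC j (c : F) : shift j (c%:MP : Pn) = c%:MP.
Proof. exact: comp_mpolyC. Qed.

Lemma shiftA i j f : shift i (shift j f) = shift (i + j) f.
Proof.
rewrite {2 3}/shift !comp_mpolyEX /shift raddf_sum; apply: eq_bigr => m _ /=.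
rewrite comp_mpolyZ !comp_mpolyX rmorph_prod; congr (_ *: _); apply: eq_bigr => k _ /=.
rewrite rmorphXn /= !tnth_mktuple -/(shift i _); congr (_ ^+ _).
rewrite /shift rmorphB /= -!/(shift i _) shiftX shiftC mxE rmorphD /= mpolyCD.
by rewrite opprD addrA.
Qed.

Lemma Omega_DE a lam u j f :
  Omega_D a lam u j f = \sum_k u 0 k *: Omega_D a lam (delta_mx 0 k) j f.
Proof.
rewrite /Omega_D; under [RHS]eq_bigr => k _ do rewrite scalerA mulrC -scalerA.
rewrite -scaler_sumr; congr (_ *: _).
under [RHS]eq_bigr => k _ do rewrite scalerAl.
rewrite -mulr_suml; congr (_ * _).
under [RHS]eq_bigr => k _ do rewrite scalerBr.
rewrite sumrB; congr (_ - _).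
  apply: eq_bigr => k _; rewrite (bigD1 k) //= big1 ?addr0 => [|l lk].
    by rewrite mxE !eqxx scale1r.
  by rewrite mxE (negPf lk) andbF scale0r.
rewrite /pairing mulr_sumr rmorph_sum; apply: eq_bigr => k _ /=.
rewrite -mul_mpolyC -mpolyCM mulrCA; congr (_ * (_ * _))%:MP.
rewrite (bigD1 k) //= big1 ?addr0 => [|l lk]; first by rewrite mxE !eqxx mul1r.
by rewrite mxE (negPf lk) andbF mul0r.
Qed.

(* The action of W_n given on all the D(u, j). *)
Lemma Omega_actD a lam u j f :
  Omega_act a lam (D u j) f = Omega_D a lam u j f.
Proof. by rewrite /Omega_act fglift_D -Omega_DE. Qed.

Lemma Omega_DD a lam u i v j f (lam0 : forall k, lam k != 0) :
  Omega_D a lam u i (Omega_D a lam v j f)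
  = (\prod_k lam k ^ ((i + j) 0 k))
      *: ((\sum_k u 0 k *: 'X_k - (a * pairing u i)%:MP)
          * ((\sum_k v 0 k *: 'X_k - (a * pairing v j)%:MP) - (pairing v i)%:MP)
          * shift (i + j) f).
Proof.
rewrite /Omega_D -[shift i _]addr0 -{2}(subrr (shift i 0)).
have -> : \prod_k lam k ^ ((i + j) 0 k)
    = (\prod_k lam k ^ (i 0 k)) * \prod_k lam k ^ (j 0 k).
  by rewrite -big_split; apply: eq_bigr => k _; rewrite mxE expfzDr.
rewrite subrr addr0 -[X in shift i X]addr0 shift_is_linear shiftM shiftA.
have -> : shift i (0 : Pn) = 0 by rewrite /shift comp_mpoly0.
rewrite addr0 -scalerA -scalerAr -!mulrA; congr (_ *: (_ *: (_ * (_ * _)))).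
have -> : shift i (\sum_k v 0 k *: 'X_k - (a * pairing v j)%:MP)
   = \sum_k v 0 k *: shift i 'X_k - (a * pairing v j)%:MP.
  rewrite /shift rmorphB raddf_sum /= comp_mpolyC; congr (_ - _).
  by apply: eq_bigr => k _; rewrite comp_mpolyZ.
rewrite addrAC; congr (_ - _); rewrite /pairing rmorph_sum /= -sumrB.
apply: eq_bigr => k _; rewrite shiftX scalerBr; congr (_ - _).
by rewrite mpolyCM mul_mpolyC.
Qed.

Lemma pairingB c d u v j :
  pairing (c *: u - d *: v) j = c * pairing u j - d * pairing v j.
Proof.
rewrite /pairing !mulr_sumr -sumrB; apply: eq_bigr => k _.
by rewrite !mxE mulrBl !mulrA.
Qed.

Lemma pairingDr u i j : pairing u (i + j) = pairing u i + pairing u j.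
Proof.
rewrite /pairing -big_split; apply: eq_bigr => k _ /=.
by rewrite mxE rmorphD mulrDr.
Qed.

Lemma Omega_act_linear a lam (X : witt F n) c f g :
  Omega_act a lam X (c *: f + g) = c *: Omega_act a lam X f + Omega_act a lam X g.
Proof.
rewrite [X]witt_sumD /Omega_act !fglift_sum scaler_sumr -big_split.
apply: eq_bigr => p _; rewrite -!/(Omega_act _ _ _ _) !Omega_actD /Omega_D.
rewrite /= shift_is_linear mulrDr scalerDr; congr (_ + _).
by rewrite -scalerAr !scalerA mulrC.
Qed.

Lemma Omega_act_sum a lam (X : witt F n) (I : Type) (r : seq I) (G : I -> Pn) :
  Omega_act a lam X (\sum_(k <- r) G k) = \sum_(k <- r) Omega_act a lam X (G k).
Proof.
have add f g :
    Omega_act a lam X (f + g) = Omega_act a lam X f + Omega_act a lam X g.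
  by have := Omega_act_linear a lam X 1 f g; rewrite !scale1r.
apply: (big_morph _ add); have := add 0 0; rewrite addr0 => E.
by apply: (addrI (Omega_act a lam X 0)); rewrite -E addr0.
Qed.

Lemma Omega_act_suml a lam (I : Type) (r : seq I) (G : I -> witt F n) f :
  Omega_act a lam (\sum_(k <- r) G k) f = \sum_(k <- r) Omega_act a lam (G k) f.
Proof. exact: fglift_sum. Qed.

Lemma witt_bracket_suml (I : Type) (r : seq I) (G : I -> witt F n) Z :
  witt_bracket (\sum_(k <- r) G k) Z = \sum_(k <- r) witt_bracket (G k) Z.
Proof. exact: fglift_sum. Qed.

Lemma witt_bracket_sumr (I : Type) (r : seq I) (G : I -> witt F n) X :
  witt_bracket X (\sum_(k <- r) G k) = \sum_(k <- r) witt_bracket X (G k).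
Proof.
rewrite [X]witt_sumD witt_bracket_suml.
under [RHS]eq_bigr => k _ do rewrite witt_bracket_suml.
rewrite exchange_big; apply: eq_bigr => p _ /=.
rewrite /witt_bracket fglift_D.
under [LHS]eq_bigr => l _ do rewrite /= fglift_sum scaler_sumr.
by rewrite exchange_big; apply: eq_bigr => l _ /=; rewrite fglift_D.
Qed.

(* Omega_{1-a}(lam) is a W_n-module. *)
Lemma Omega_act_bracket a lam (X Z : witt F n) f (lam0 : forall k, lam k != 0) :
  Omega_act a lam (witt_bracket X Z) f
  = Omega_act a lam X (Omega_act a lam Z f)
    - Omega_act a lam Z (Omega_act a lam X f).
Proof.
rewrite [X]witt_sumD [Z]witt_sumD witt_bracket_suml !Omega_act_suml.
under [X in _ = X - _]eq_bigr => p _ do rewrite Omega_act_sum.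
under [X in _ = _ - X]eq_bigr => p _ do rewrite Omega_act_sum.
rewrite [X in _ = _ - X]exchange_big -sumrB; apply: eq_bigr => p _ /=.
rewrite witt_bracket_sumr Omega_act_suml -sumrB; apply: eq_bigr => q _ /=.
rewrite witt_bracket_D !Omega_actD !Omega_DD //.
move: (coeff _ _ *: _) (coeff _ _ *: _) p.1 q.1 => v u i j.
rewrite [j + i]addrC /Omega_D -scalerBr -mulrBl; congr (_ *: (_ * _)).
have -> : \sum_k (pairing u j *: v - pairing v i *: u) 0 k *: 'X_k
   = (pairing u j)%:MP * (\sum_k v 0 k *: 'X_k)
     - (pairing v i)%:MP * (\sum_k u 0 k *: 'X_k) :> Pn.
  rewrite !mulr_sumr -sumrB; apply: eq_bigr => k _.
  by rewrite !mxE scalerBl !mul_mpolyC !scalerA.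
rewrite pairingB !pairingDr !(mpolyCM, mpolyCB, mpolyCD).
ring.
Qed.

Definition svec (j : 'I_n.+1) : 'rV[F]_n :=
  if unlift ord_max j is Some j' then delta_mx 0 j' else const_mx (-1).

Definition wvec (i : 'I_n.+1) : 'rV[int]_n :=
  if unlift ord_max i is Some i' then tuniti i' else 0.

Lemma D_const j : - \sum_(k < n) D (delta_mx 0 k) j = D (const_mx (-1)) j :> witt F n.
Proof.
rewrite -sumrN; apply: eq_bigr => k _; rewrite mxE scaleN1r; congr (- _).
rewrite /D (bigD1 k) //= big1 ?addr0 => [|l lk].
  by rewrite mxE !eqxx scale1r.
by rewrite mxE (negPf lk) andbF scale0r.
Qed.

Lemma sl_eE (i j : 'I_n.+1) : sl_e F i j = D (svec j) (wvec i - wvec j).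
Proof.
rewrite /sl_e /svec /wvec.
case: unliftP => [i' _|_]; case: unliftP => [j' _|_] //.
- by rewrite D_const subr0.
- by rewrite sub0r.
- by rewrite D_const subrr.
Qed.

Lemma pairing_delta (k : 'I_n) i : pairing (delta_mx 0 k) i = (i 0 k)%:~R :> F.
Proof.
rewrite /pairing (bigD1 k) //= big1 ?addr0 => [|l lk].
  by rewrite mxE !eqxx mul1r.
by rewrite mxE (negPf lk) andbF mul0r.
Qed.

Lemma pairing_svec (j k : 'I_n.+1) :
  pairing (svec j) (wvec k) = (j == k)%:R - (j == ord_max)%:R.
Proof.
rewrite /svec /wvec.
case: unliftP => [j' ->|->]; case: unliftP => [k' ->|->].
- rewrite pairing_delta mxE eqxx (inj_eq lift_inj) /= -(negbK (_ == ord_max)).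
  by rewrite [_ == ord_max]eq_sym neq_lift subr0; case: eqP.
- by rewrite pairing_delta mxE subrr.
- rewrite /pairing (bigD1 k') //= big1 ?addr0 => [|l lk].
    by rewrite !mxE !eqxx mulr1 (negPf (neq_lift _ _)) sub0r.
  by rewrite !mxE (negPf lk) andbF mulr0.
- by rewrite /pairing big1 ?eqxx ?subrr // => l _; rewrite !mxE mulr0.
Qed.

Lemma pairingN u j : pairing u (- j) = - pairing u j.
Proof.
by rewrite /pairing -sumrN; apply: eq_bigr => k _; rewrite mxE rmorphN mulrN.
Qed.

Lemma sl_e_bracket (i j k l : 'I_n.+1) :
  witt_bracket (sl_e F i j) (sl_e F k l)
  = (j == k)%:R *: sl_e F i l - (l == i)%:R *: sl_e F k j.
Proof.
rewrite !sl_eE witt_bracket_D !(pairingDr, pairingN) !pairing_svec DB.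
have -> : (j == k)%:R - (j == ord_max)%:R - ((j == l)%:R - (j == ord_max)%:R)
   = (j == k)%:R - (j == l)%:R :> F by ring.
have -> : (l == i)%:R - (l == ord_max)%:R - ((l == j)%:R - (l == ord_max)%:R)
   = (l == i)%:R - (l == j)%:R :> F by ring.
rewrite !scalerBl [l == j]eq_sym.
have E1 : (j == k)%:R *: D (svec l) (wvec i - wvec j + (wvec k - wvec l))
   = (j == k)%:R *: D (svec l) (wvec i - wvec l).
  by case: eqP => [->|]; rewrite ?scale0r // addrA subrK.
have E2 : (l == i)%:R *: D (svec j) (wvec i - wvec j + (wvec k - wvec l))
   = (l == i)%:R *: D (svec j) (wvec k - wvec j).
  case: eqP => [->|]; rewrite ?scale0r // addrC addrA subrK //.
have E3 : (j == l)%:R *: D (svec l) (wvec i - wvec j + (wvec k - wvec l))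
   = (j == l)%:R *: D (svec j) (wvec i - wvec j + (wvec k - wvec l)).
  by case: eqP => [->|]; rewrite ?scale0r.
by rewrite E1 E2 E3 opprB addrA subrK.
Qed.

Lemma sl_embedB (x y : 'M[F]_n.+1) : sl_embed (x - y) = sl_embed x - sl_embed y.
Proof.
rewrite /sl_embed -sumrB; apply: eq_bigr => i _; rewrite -sumrB.
by apply: eq_bigr => j _; rewrite !mxE scalerBl.
Qed.

Lemma witt_bracketZZ c d (X Z : witt F n) :
  witt_bracket (c *: X) (d *: Z) = (c * d) *: witt_bracket X Z.
Proof.
rewrite /witt_bracket fgliftZ [X]witt_sumD !fglift_sum -scalerA.
congr (_ *: _); rewrite scaler_sumr; apply: eq_bigr => p _.
rewrite !fglift_D scaler_sumr; apply: eq_bigr => k _.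
by rewrite fgliftZ !scalerA mulrC.
Qed.

Lemma sl_embed_bracket (x y : 'M[F]_n.+1) :
  sl_embed (x *m y - y *m x) = witt_bracket (sl_embed x) (sl_embed y).
Proof.
have R (z t : 'M[F]_n.+1) : sl_embed (z *m t)
    = \sum_i \sum_j \sum_k (z i j * t j k) *: sl_e F i k.
  apply: eq_bigr => i _; rewrite [RHS]exchange_big; apply: eq_bigr => k _ /=.
  by rewrite mxE scaler_suml.
rewrite sl_embedB !R {1}/sl_embed witt_bracket_suml.
have L (i j : 'I_n.+1) : witt_bracket (x i j *: sl_e F i j) (sl_embed y)
    = \sum_k (x i j * y j k) *: sl_e F i k
      - \sum_k (y k i * x i j) *: sl_e F k j.
  rewrite /sl_embed witt_bracket_sumr.
  under eq_bigr => k _ do rewrite witt_bracket_sumr.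
  under eq_bigr => k _ do under eq_bigr => l _ do
    rewrite witt_bracketZZ sl_e_bracket scalerBr.
  under eq_bigr => k _ do rewrite sumrB.
  rewrite sumrB; congr (_ - _).
    rewrite (bigD1 j) //= [X in _ + X]big1 ?addr0 => [|k kj].
      by apply: eq_bigr => l _; rewrite eqxx scale1r.
    by rewrite big1 // => l _; rewrite eq_sym (negPf kj) scale0r scaler0.
  apply: eq_bigr => k _; rewrite (bigD1 i) //= big1 ?addr0 => [|l li].
    by rewrite eqxx scale1r mulrC.
  by rewrite (negPf li) scale0r scaler0.
under [RHS]eq_bigr => i _ do rewrite witt_bracket_suml.
under [RHS]eq_bigr => i _ do under eq_bigr => j _ do rewrite L.
under [RHS]eq_bigr => i _ do rewrite sumrB.
rewrite sumrB; congr (_ - _).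
rewrite exchange_big; apply: eq_bigr => i _ /=.
by rewrite exchange_big.
Qed.

Lemma Omega_sl_bracket a lam (x y : 'M[F]_n.+1) f (lam0 : forall k, lam k != 0) :
  Omega_sl a lam (x *m y - y *m x) f
  = Omega_sl a lam x (Omega_sl a lam y f) - Omega_sl a lam y (Omega_sl a lam x f).
Proof. by rewrite /Omega_sl sl_embed_bracket Omega_act_bracket. Qed.

Section Stable.
Variables (a : F) (m : nat).
Hypothesis ha : n.+1%:R * a = - m%:R.

Notation Wam := (@W F n a m).

Lemma W0 : Wam 0.
Proof. by exists (fun=> 0); rewrite big1 // => j _; rewrite mul0r. Qed.

Lemma W_add f g : Wam f -> Wam g -> Wam (f + g).
Proof.
case=> f' -> [g' ->]; exists (fun j : 'X_{1..n < m.+2} => f' j + g' j).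
by rewrite -big_split; apply: eq_bigr => j _; rewrite mulrDl.
Qed.

Lemma W_mul h f : Wam f -> Wam (h * f).
Proof.
case=> f' ->; exists (fun j : 'X_{1..n < m.+2} => h * f' j).
by rewrite mulr_sumr; apply: eq_bigr => j _; rewrite mulrA.
Qed.

Lemma W_scale c f : Wam f -> Wam (c *: f).
Proof. by rewrite -mul_mpolyC; exact: W_mul. Qed.

Lemma W_sum (I : Type) (r : seq I) (P : pred I) (G : I -> Pn) :
  (forall k, P k -> Wam (G k)) -> Wam (\sum_(k <- r | P k) G k).
Proof. by move=> h; apply: (big_ind Wam W0 W_add). Qed.

Lemma W_Y (j : 'X_{1..n}) : mdeg j = m.+1 -> Wam (Y a j).
Proof.
move=> hj; have lj : (mdeg j < m.+2)%N by rewrite hj.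
exists (fun k => (k == BMultinom lj)%:R).
rewrite (bigD1 (BMultinom lj)) /= ?hj // eqxx mul1r big1 ?addr0 // => k.
by case/andP=> _ /negPf ->; rewrite mul0r.
Qed.

Lemma W_prod (j : 'X_{1..n}) (h q : 'I_n -> Pn) : mdeg j = m.+1 ->
  (forall k, h k = q k * Yfac a k (j k)) -> Wam (\prod_k h k).
Proof.
move=> hj hq; rewrite (eq_bigr _ (fun k _ => hq k)) big_split /=.
by apply: W_mul; exact: W_Y.
Qed.

Lemma YfacS (k : 'I_n) (j : nat) :
  Yfac a k j.+1 = Yfac a k j * ('X_k + (a + j%:R)%:MP).
Proof. by rewrite /Yfac big_ord_recr. Qed.

Lemma shift_Yfac i (k : 'I_n) l :
  shift i (Yfac a k l) = \prod_(r < l) ('X_k + (a + r%:R - (i 0 k)%:~R)%:MP).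
Proof.
rewrite /shift rmorph_prod; apply: eq_bigr => r _ /=.
rewrite rmorphD /= comp_mpolyC -/(shift i _) shiftX mpolyCB.
by rewrite addrAC addrA.
Qed.

Lemma shift_Yfac0 i (k : 'I_n) l : i 0 k = 0 -> shift i (Yfac a k l) = Yfac a k l.
Proof.
by move=> h; rewrite shift_Yfac h; apply: eq_bigr => r _; rewrite subr0.
Qed.

Lemma shift_Yfac1 i (k : 'I_n) l : i 0 k = 1 ->
  shift i (Yfac a k l.+1) = ('X_k + (a - 1)%:MP) * Yfac a k l.
Proof.
move=> h; rewrite shift_Yfac h big_ord_recl /= addr0; congr (_ * _).
apply: eq_bigr => r _; congr (_ + _%:MP).
by rewrite /bump /= add1n -natr1; ring.
Qed.

Lemma shift_YfacN1 i (k : 'I_n) l : i 0 k = -1 ->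
  ('X_k + a%:MP) * shift i (Yfac a k l) = Yfac a k l.+1.
Proof.
move=> h; rewrite shift_Yfac h /Yfac big_ord_recl /= addr0; congr (_ * _).
apply: eq_bigr => r _; congr (_ + _%:MP).
by rewrite /bump /= add1n -natr1; ring.
Qed.

Lemma shift_Y i (j : 'X_{1..n}) : shift i (Y a j) = \prod_k shift i (Yfac a k (j k)).
Proof. by rewrite /shift rmorph_prod. Qed.

Lemma mul_prod (h : 'I_n -> Pn) k (p : Pn) :
  p * \prod_l h l = \prod_l (if l == k then p * h l else h l).
Proof.
rewrite [in LHS](bigD1 k) // [in RHS](bigD1 k) //= eqxx mulrA; congr (_ * _).
by apply: eq_bigr => l /negPf ->.
Qed.

Lemma W_lower (k : 'I_n) i (j : 'X_{1..n}) : i 0 k = -1 ->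
  (forall l, l != k -> i 0 l = 0) -> mdeg j = m.+1 ->
  Wam (('X_k + a%:MP) * shift i (Y a j)).
Proof.
move=> hk hi hj; rewrite shift_Y (mul_prod _ k).
apply: (@W_prod j _ (fun l => if l == k then 'X_k + (a + (j k)%:R)%:MP else 1)) => // l.
case: eqP => [->|/eqP lk]; first by rewrite shift_YfacN1 // YfacS mulrC.
by rewrite shift_Yfac0 ?hi // mul1r.
Qed.

Lemma mdegDB (j : 'X_{1..n}) (k l : 'I_n) : (0 < j l)%N ->
  mdeg (j + U_(k) - U_(l))%MM = mdeg j.
Proof.
move=> jl; have h : (U_(l) <= j + U_(k))%MM.
  apply/mnm_lepP => r; rewrite mnm1E mnmDE; case: eqP => [<-|] //=.
  by rewrite addn_gt0 jl.
have := mdegD (j + U_(k) - U_(l))%MM U_(l)%MM.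
by rewrite submK // mdegD !mdeg1 => /eqP; rewrite eqn_add2r => /eqP.
Qed.

Lemma W_cross (k l : 'I_n) i (j : 'X_{1..n}) : k != l -> i 0 k = -1 -> i 0 l = 1 ->
  (forall r, r != k -> r != l -> i 0 r = 0) -> mdeg j = m.+1 ->
  Wam (('X_k + a%:MP) * shift i (Y a j)).
Proof.
move=> kl ik il hi hj; rewrite shift_Y (mul_prod _ k).
case jl: (j l) => [|jl'].
  apply: (@W_prod j _ (fun r => if r == k then 'X_k + (a + (j k)%:R)%:MP else 1)) => // r.
  case: eqP => [->|/eqP rk]; first by rewrite shift_YfacN1 // YfacS mulrC.
  have [->|rl] := eqVneq r l; last by rewrite shift_Yfac0 ?hi // mul1r.
  by rewrite jl /Yfac !big_ord0 /shift comp_mpoly1 mul1r.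
apply: (@W_prod (j + U_(k) - U_(l))%MM _
  (fun r => if r == l then 'X_l + (a - 1)%:MP else 1)) => [|r].
  by rewrite mdegDB ?jl.
rewrite mnmBE mnmDE !mnm1E; have [->|rk] := eqVneq r k.
  by rewrite ?eqxx 1?[l == k]eq_sym !(negPf kl) subn0 addn1 mul1r shift_YfacN1.
rewrite addn0; have [->|rl] := eqVneq r l.
  by rewrite ?eqxx jl subn1 shift_Yfac1.
by rewrite subn0 mul1r shift_Yfac0 ?hi.
Qed.

Lemma W_raise (l : 'I_n) i (j : 'X_{1..n}) : i 0 l = 1 ->
  (forall r, r != l -> i 0 r = 0) -> mdeg j = m.+1 ->
  Wam ((\sum_k 'X_k - a%:MP) * shift i (Y a j)).
Proof.
move=> il hi hj.
have E : \sum_k 'X_k - a%:MP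
    = \sum_(k | k != l) ('X_k + (a + (j k)%:R)%:MP)
      + ('X_l + (a + (j l)%:R - 1)%:MP) :> Pn.
  have -> : \sum_(k | k != l) ('X_k + (a + (j k)%:R)%:MP)
      + ('X_l + (a + (j l)%:R - 1)%:MP)
      = \sum_k ('X_k + (a + (j k)%:R)%:MP) - 1%:MP :> Pn.
    by rewrite [in RHS](bigD1 l) //= mpolyCB; ring.
  rewrite big_split /= -rmorph_sum /= big_split /= -natr_sum -mdegE hj.
  rewrite sumr_const card_ord -addrA -mpolyCB; congr (_ + _).
  rewrite -mpolyCN; congr (_%:MP).
  by rewrite -natr1 -[m%:R]opprK -ha -natr1 mulrDl mul1r mulr_natl; ring.
rewrite E mulrDl mulr_suml; apply: W_add; last first.
  case jl: (j l) => [|jl'].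
    apply: W_mul; rewrite shift_Y.
    apply: (@W_prod j _ (fun=> 1)) => // r; rewrite mul1r.
    have [->|rl] := eqVneq r l; last by rewrite shift_Yfac0 ?hi.
    by rewrite jl /Yfac !big_ord0 /shift comp_mpoly1.
  rewrite shift_Y (mul_prod _ l).
  apply: (@W_prod j _ (fun r => if r == l then 'X_l + (a - 1)%:MP else 1)) => // r.
  case: eqP => [->|/eqP rl]; last by rewrite shift_Yfac0 ?hi // mul1r.
  rewrite jl shift_Yfac1 // YfacS -natr1.
  have -> : a + (jl'%:R + 1) - 1 = a + jl'%:R by ring.
  by ring.
apply: W_sum => k kl; rewrite shift_Y (mul_prod _ k).
case jl: (j l) => [|jl'].
  apply: (@W_prod j _ (fun r => if r == k then 'X_k + (a + (j k)%:R)%:MP else 1)) => // r.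
  have [->|rl] := eqVneq r l.
    by rewrite eq_sym (negPf kl) jl /Yfac !big_ord0 /shift comp_mpoly1 mul1r.
  by rewrite shift_Yfac0 ?hi //; case: eqP => [->|_]; rewrite ?mul1r.
apply: (@W_prod (j + U_(k) - U_(l))%MM _
  (fun r => if r == l then 'X_l + (a - 1)%:MP else 1)) => [|r].
  by rewrite mdegDB ?jl.
rewrite mnmBE mnmDE !mnm1E; have [->|rk] := eqVneq r k.
  rewrite ?eqxx 1?[l == k]eq_sym !(negPf kl) subn0 addn1 mul1r YfacS mulrC.
  by rewrite shift_Yfac0 ?hi.
rewrite addn0; have [->|rl] := eqVneq r l.
  by rewrite ?eqxx jl subn1 shift_Yfac1.
by rewrite subn0 mul1r shift_Yfac0 ?hi.
Qed.

Lemma W_sl_e lam (i j : 'I_n.+1) f : Wam f -> Wam (Omega_act a lam (sl_e F i j) f).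
Proof.
case=> g ->.
have -> : \sum_(k : 'X_{1..n < m.+2} | mdeg k == m.+1) g k * Y a k
   = \sum_(k <- [seq k : 'X_{1..n < m.+2} <- index_enum _ | mdeg k == m.+1]) g k * Y a k.
  by rewrite big_filter.
rewrite Omega_act_sum big_filter; apply: W_sum => k /eqP hk.
rewrite sl_eE Omega_actD /Omega_D; apply: W_scale.
rewrite shiftM mulrCA; apply: W_mul.
have -> : pairing (svec j) (wvec i - wvec j) = (j == i)%:R - 1.
  by rewrite pairingDr pairingN !pairing_svec eqxx /=; ring.
have [->|ji] := eqVneq j i.
  rewrite shift_Y; apply: W_mul; apply: (@W_prod k _ (fun=> 1)) => // l.
  by rewrite mul1r shift_Yfac0 // subrr mxE.
rewrite sub0r mulrN1 mpolyCN opprK /svec /wvec.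
have Xdelta (l : 'I_n) : \sum_r (delta_mx 0 l : 'rV[F]_n) 0 r *: 'X_r = 'X_l :> Pn.
  rewrite (bigD1 l) //= big1 ?addr0 => [|r rl].
    by rewrite mxE !eqxx scale1r.
  by rewrite mxE (negPf rl) andbF scale0r.
case: unliftP ji => [j' ->|->]; case: unliftP => [i' ->|->] ji.
- rewrite (inj_eq lift_inj) in ji; rewrite Xdelta.
  apply: (W_cross ji) => // [||r rj ri]; rewrite !mxE !eqxx.
  + by rewrite (negPf ji).
  + by rewrite eq_sym (negPf ji) subr0.
  + by rewrite (negPf rj) (negPf ri).
- rewrite Xdelta; apply: W_lower => // [|r rj]; rewrite !mxE ?eqxx ?sub0r //.
  by rewrite (negPf rj) andbF.
- have -> : \sum_r (const_mx (-1) : 'rV[F]_n) 0 r *: 'X_r + a%:MP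
      = (-1)%:MP * (\sum_r 'X_r - a%:MP) :> Pn.
    rewrite mpolyCN mulN1r opprB addrC -sumrN; congr (_ + _).
    by apply: eq_bigr => r _; rewrite mxE scaleN1r.
  rewrite -mulrA; apply: W_mul; apply: (@W_raise i') => // [|r ri].
    by rewrite !mxE !eqxx subr0.
  by rewrite !mxE (negPf ri) andbF subr0.
- by rewrite eqxx in ji.
Qed.

Lemma W_stable lam (x : 'M[F]_n.+1) f : Wam f -> Wam (Omega_sl a lam x f).
Proof.
move=> hf; rewrite /Omega_sl /sl_embed Omega_act_suml; apply: W_sum => i _.
rewrite Omega_act_suml; apply: W_sum => j _.
by rewrite /Omega_act fgliftZ; apply: W_scale; exact: W_sl_e.
Qed.

End Stable.

End Facts.

(* Main.v *)
Require Import Defs.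
From mathcomp Require Import all_boot all_order all_algebra.
From mathcomp Require Import complex reals mpoly.
From mathcomp Require Import classical_sets functions boolp.
From mathcomp Require Import ring.

(** The traceless diagonal matrices act on the polynomial ring as multiplication
    by linear forms, and those forms span all the variables since n + 1 is
    invertible ([Omega_sl_cartan]).  Hence an isomorphism phi of
    sl_{n+1}-modules between two of the ideals W is linear over the whole
    polynomial ring ([intertwiner_mul]), so g * phi f = f * phi g for all f, g in
    the source ([intertwiner_ratio]): phi is multiplication by a fixed rational
    function r = phi g / g.

    Write sigma for the translation X_i -> X_i + 1 and s for the sum of all the
    variables.  Commuting phi with the lowering operator E_{n+1,i} and with the
    raising operator E_{i,n+1} gives two formulas for the same quotient
    ([intertwiner_lower], [intertwiner_raise]):
      sigma r / r = (lam'_i / lam_i) * (X_i + a) / (X_i + a')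
                  = (lam'_i / lam_i) * (s + 1 - a') / (s + 1 - a).
    So (X_i + a) (s + 1 - a) = (X_i + a') (s + 1 - a'), and as there is a
    variable other than X_i, on which s depends and X_i + a does not, this forces
    a = a'.  What is left is sigma r = (lam'_i / lam_i) r; a translation does not
    change the leading term of a polynomial ([mlead_shift_le], [mleadc_shift]),
    so lam_i = lam'_i.

    Conversely, a = a' determines m in characteristic zero, and the two modules
    are then the same. *)
Import Order.POrderTheory Order.BJoinTheory GRing.Theory.
Local Open Scope ring_scope.

Set Implicit Arguments.
Unset Strict Implicit.

(** * Translations and leading terms *)

Section Shift.
Variables (F : fieldType) (n : nat).
Notation Pn := {mpoly F[n]}.
Implicit Types (j : 'rV[int]_n) (p q : Pn).

Lemma shift0 p : shift 0 p = p.
Proof.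
rewrite /shift -[RHS]comp_mpoly_id; congr (_ \mPo _).
by apply: eq_from_tnth => i; rewrite !tnth_mktuple mxE mulr0z subr0.
Qed.

(** A translate of a monomial is a product of factors 'X_i - c, each with leading
    monomial 'X_i because the order refines the total degree. *)
Lemma mlead_shift_monomial j (m : 'X_{1..n}) :
  mlead (shift j 'X_[m] : Pn) = m /\ mleadc (shift j 'X_[m] : Pn) = 1.
Proof.
have lt0U i : (mlead (- ((j 0 i)%:~R)%:MP : Pn)
               < mlead ('X_i : Pn))%O.
  by rewrite mleadN mleadC mleadXm lt_mdeg_ltmc // mdeg0 mdeg1.
have leadX i : mlead (shift j 'X_i : Pn) = U_(i)%MM.
  by rewrite shiftX mleadDl // mleadXm.
have leadcX i : mleadc (shift j 'X_i : Pn) = 1.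
  rewrite leadX shiftX mcoeffB mcoeffX eqxx mcoeffC.
  by rewrite -mdeg_eq0 mdeg1 mulr0 subr0.
have reg1 : GRing.lreg (1 : F) by exact: lreg1.
have E : shift j 'X_[m] = \prod_i (shift j 'X_i) ^+ (m i) :> Pn.
  rewrite mpolyXE_id /shift rmorph_prod; apply: eq_bigr => i _ /=.
  by rewrite rmorphXn.
have leadcXk i k : mleadc (shift j 'X_i ^+ k : Pn) = 1.
  by rewrite mleadcX_proper leadcX ?expr1n.
rewrite E; split.
  rewrite mlead_prod_proper => [|i _ _]; last by rewrite leadcXk.
  rewrite [RHS]multinomUE_id; apply: eq_bigr => i _.
  by rewrite mleadX_proper ?leadcX // leadX.
rewrite mleadc_prod_proper => [|i _ _]; last by rewrite leadcXk.
by rewrite big1 // => i _; rewrite leadcXk.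
Qed.

Lemma shift_sum_monomials j p :
  shift j p = \sum_(m <- msupp p) p@_m *: shift j 'X_[m].
Proof.
rewrite {1}[p]mpolyE /shift raddf_sum; apply: eq_bigr => m _ /=.
by rewrite comp_mpolyZ.
Qed.

Lemma mlead_shift_le j p : (mlead (shift j p) <= mlead p)%O.
Proof.
rewrite shift_sum_monomials.
apply: le_trans (mlead_sum_le _ _ _) _.
apply/joinsP_seq => m hm _.
apply: le_trans (mleadZ_le _ _) _.
by rewrite (mlead_shift_monomial j m).1 msupp_le_mlead.
Qed.

Lemma mleadc_shift j p : (shift j p)@_(mlead p) = mleadc p.
Proof.
have [->|p0] := eqVneq p 0; first by rewrite /shift comp_mpoly0.
rewrite shift_sum_monomials raddf_sum /= (bigD1_seq (mlead p)) ?mlead_supp //=.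
have [h1 h2] := mlead_shift_monomial j (mlead p).
rewrite mcoeffZ; rewrite h1 in h2; rewrite h2 mulr1 big_seq_cond big1 ?addr0 // => m.
case/andP=> hm ne; rewrite mcoeffZ [X in _ * X]mcoeff_gt_mlead ?mulr0 //.
by rewrite (mlead_shift_monomial j m).1 lt_neqAle ne msupp_le_mlead.
Qed.

Lemma shift_eq0 j p : (shift j p == 0) = (p == 0).
Proof.
apply/eqP/eqP => [h|->]; last by rewrite /shift comp_mpoly0.
by apply/eqP; rewrite -mleadc_eq0 -(mleadc_shift j) h mcoeff0.
Qed.

Lemma mleadc_mul_shift j p q :
  (p * shift j q)@_(mlead p + mlead q) = mleadc p * mleadc q.
Proof. by rewrite mleadcMW ?mlead_shift_le // mleadc_shift. Qed.

End Shift.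

(** * The action of the Cartan, lowering and raising matrices *)

Lemma mxtrace_delta (F : fieldType) (n : nat) (i j : 'I_n) :
  i != j -> \tr (delta_mx i j : 'M[F]_n) = 0.
Proof.
move=> ij; rewrite /mxtrace big1 // => k _; rewrite mxE.
by have [->|] := eqVneq k i; rewrite // (negPf ij).
Qed.

Section Action.
Variables (F : fieldType) (n : nat).
Notation Pn := {mpoly F[n]}.
Variables (a : F) (lam : 'I_n -> F).
Implicit Types (p f : Pn) (i : 'I_n).

Definition linear_form (u : 'rV[F]_n) : Pn := \sum_k u 0 k *: 'X_k.

Lemma linear_form_delta i : linear_form (delta_mx 0 i) = 'X_i.
Proof.
rewrite /linear_form (bigD1 i) //= big1 ?addr0 => [|r ri].
  by rewrite mxE !eqxx scale1r.
by rewrite mxE (negPf ri) andbF scale0r.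
Qed.

Lemma linear_form_const c : linear_form (const_mx c) = c *: \sum_k 'X_k.
Proof. by rewrite scaler_sumr; apply: eq_bigr => k _; rewrite mxE. Qed.

Lemma Omega_slE (x : 'M[F]_n.+1) f :
  Omega_sl a lam x f
  = \sum_i \sum_j x i j *: Omega_D a lam (svec F j) (wvec i - wvec j) f.
Proof.
rewrite /Omega_sl /sl_embed Omega_act_suml; apply: eq_bigr => i _.
rewrite Omega_act_suml; apply: eq_bigr => j _.
by rewrite /Omega_act fgliftZ -/(Omega_act a lam _ f) sl_eE Omega_actD.
Qed.

Lemma Omega_sl_delta (i j : 'I_n.+1) f :
  Omega_sl a lam (delta_mx i j) f = Omega_D a lam (svec F j) (wvec i - wvec j) f.
Proof.
rewrite Omega_slE (bigD1 i) //= [X in _ + X]big1 ?addr0 => [|k ki].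
  rewrite (bigD1 j) //= big1 ?addr0 => [|k kj]; first by rewrite mxE !eqxx scale1r.
  by rewrite mxE (negPf kj) andbF scale0r.
by rewrite big1 // => l _; rewrite mxE (negPf ki) scale0r.
Qed.

Lemma Omega_sl_diag (d : 'rV[F]_n.+1) f :
  Omega_sl a lam (diag_mx d) f = (\sum_k d 0 k *: linear_form (svec F k)) * f.
Proof.
rewrite Omega_slE mulr_suml; apply: eq_bigr => k _.
rewrite (bigD1 k) //= big1 ?addr0 => [|l lk]; last first.
  by rewrite mxE eq_sym (negPf lk) mulr0n scale0r.
rewrite mxE eqxx mulr1n -scalerAl subrr /Omega_D shift0.
rewrite big1 ?scale1r => [|r _]; last by rewrite mxE.
rewrite [pairing _ 0]big1 => [|r _]; last by rewrite mxE mulr0z mulr0.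
by rewrite mulr0 mpolyC0 subr0.
Qed.

(** The identity matrix acts as multiplication by this sum, so scalar matrices act
    by zero and a matrix can be made traceless without changing its action. *)
Lemma sum_linear_form_svec : \sum_k linear_form (svec F k) = 0 :> Pn.
Proof.
rewrite (bigD1 ord_max) //= [in svec F ord_max]/svec unlift_none.
rewrite linear_form_const scaleN1r; apply/eqP; rewrite addrC subr_eq0; apply/eqP.
rewrite big_mkcond big_ord_recr /= eqxx addr0; apply: eq_bigr => i _.
have -> : widen_ord (leqnSn n) i = lift ord_max i.
  by apply: val_inj; apply/esym; exact: lift_max.
by rewrite eq_sym neq_lift /svec liftK linear_form_delta.
Qed.

(** The traceless part of E_{ii}. *)
Definition cartan i : 'M[F]_n.+1 :=
  diag_mx (delta_mx 0 (lift ord_max i) - const_mx n.+1%:R^-1).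

Hypothesis n1 : n.+1%:R != 0 :> F.

Lemma cartan_trace i : \tr (cartan i) = 0.
Proof.
rewrite mxtrace_diag; under eq_bigr => k _ do rewrite !mxE.
rewrite sumrB sumr_const card_ord -(mulr_natr n.+1%:R^-1) mulVf //.
rewrite (bigD1 (lift ord_max i)) //= big1 ?addr0 => [|k ki].
  by rewrite eqxx subrr.
by rewrite (negPf ki).
Qed.

Lemma Omega_sl_cartan i f : Omega_sl a lam (cartan i) f = 'X_i * f.
Proof.
rewrite Omega_sl_diag; congr (_ * _).
under eq_bigr => k _ do rewrite !mxE scalerBl.
rewrite sumrB -scaler_sumr sum_linear_form_svec scaler0 subr0.
rewrite (bigD1 (lift ord_max i)) //= big1 ?addr0 => [|k ki].
  by rewrite !eqxx scale1r /svec liftK linear_form_delta.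
by rewrite (negPf ki) scale0r.
Qed.

Lemma Omega_sl_lower i f :
  Omega_sl a lam (delta_mx ord_max (lift ord_max i)) f
  = (lam i)^-1 *: (('X_i + a%:MP) * shift (- tuniti i) f).
Proof.
rewrite Omega_sl_delta /Omega_D /svec /wvec unlift_none liftK sub0r.
rewrite pairingN pairing_delta mxE !eqxx mulr1z mulrN1 mpolyCN opprK.
rewrite -/(linear_form _) linear_form_delta; congr (_ *: _).
rewrite (bigD1 i) //= big1 ?mulr1 => [|k ki]; rewrite !mxE ?eqxx //.
by rewrite (negPf ki) oppr0.
Qed.

Lemma Omega_sl_raise i f :
  Omega_sl a lam (delta_mx (lift ord_max i) ord_max) f
  = - lam i *: ((\sum_k 'X_k - a%:MP) * shift (tuniti i) f).
Proof.
rewrite Omega_sl_delta /Omega_D /svec /wvec unlift_none liftK subr0.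
have -> : pairing (const_mx (-1)) (tuniti i) = -1 :> F.
  rewrite /pairing (bigD1 i) //= big1 ?addr0 => [|k ki]; rewrite !mxE ?eqxx ?mulr1 //.
  by rewrite (negPf ki) mulr0.
have -> : \prod_k lam k ^ (tuniti i 0 k) = lam i.
  rewrite (bigD1 i) //= big1 ?mulr1 => [|k ki]; rewrite !mxE ?eqxx //.
  by rewrite (negPf ki).
rewrite -/(linear_form _) linear_form_const scaleN1r mulrN1 mpolyCN opprK.
by rewrite scaleNr -scalerN -mulNr opprB addrC.
Qed.

End Action.

(** * Induction on polynomials, and a nonzero element of W *)

Lemma mpoly_alg_ind (F : fieldType) (n : nat) (P : {mpoly F[n]} -> Prop) :
  P 1 -> (forall i, P 'X_i) ->
  (forall c p q, P p -> P q -> P (c *: p + q)) ->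
  (forall p q, P p -> P q -> P (p * q)) -> forall p, P p.
Proof.
move=> P1 PX PD PM; elim/mpolyind => [|c m p _ _ Pp].
  by rewrite -(addNr 1) -scaleN1r; apply: PD.
apply: PD => //; rewrite mpolyXE_id; apply: big_ind => // i _.
by elim: (m i) => [|k IHk]; rewrite ?expr0 // exprS; apply: PM.
Qed.

Lemma mpolyX_addC_neq0 (F : fieldType) (n : nat) (i : 'I_n) (c : F) :
  'X_i + c%:MP != 0 :> {mpoly F[n]}.
Proof.
apply: contra_neq (@oner_neq0 F) => /(congr1 (mcoeff U_(i)%MM)).
by rewrite mcoeffD mcoeffX eqxx mcoeffC -mdeg_eq0 mdeg1 mulr0 addr0 mcoeff0.
Qed.

Lemma W_neq0 (F : fieldType) (n : nat) (a : F) (m : nat) (i : 'I_n) :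
  exists2 g : {mpoly F[n]}, W a m g & g != 0.
Proof.
exists (Y a (U_(i) *+ m.+1)%MM).
  by apply: W_Y; rewrite mdegMn mdeg1 mul1n.
apply/prodf_neq0 => k _; apply/prodf_neq0 => l _; exact: mpolyX_addC_neq0.
Qed.

(** * Intertwiners are multiplications by a rational function *)

Section Rigidity.
Variables (F : fieldType) (n : nat).
Notation Pn := {mpoly F[n]}.
Hypotheses (n_gt1 : (1 < n)%N) (n1 : n.+1%:R != 0 :> F).
Variables (lam lam' : 'I_n -> F) (a a' : F) (m m' : nat).
Hypotheses (lam0 : forall i, lam i != 0) (lam'0 : forall i, lam' i != 0).
Hypothesis ha : n.+1%:R * a = - m%:R.

Section Intertwiner.
Variable phi : Pn -> Pn.
Hypotheses
  (phi_lin : forall c f g, W a m f -> W a m g ->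
     phi (c *: f + g) = c *: phi f + phi g)
  (phi_sl : forall (x : 'M[F]_n.+1) f, \tr x = 0 -> W a m f ->
     phi (Omega_sl a lam x f) = Omega_sl a' lam' x (phi f)).

Lemma intertwiner_mul p f : W a m f -> phi (p * f) = p * phi f.
Proof.
elim/mpoly_alg_ind: p f => [f|i f|c p q IHp IHq f|p q IHp IHq f] Wf.
- by rewrite !mul1r.
- by rewrite -(Omega_sl_cartan a lam) // phi_sl ?cartan_trace // Omega_sl_cartan.
- rewrite mulrDl -scalerAl phi_lin ?IHp ?IHq ?mulrDl -?scalerAl //; exact: W_mul.
- by rewrite -mulrA IHp ?IHq ?mulrA //; apply: W_mul.
Qed.

(** The denominator-free form of phi f = f * (phi g / g). *)
Lemma intertwiner_ratio f g : W a m f -> W a m g -> g * phi f = f * phi g.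
Proof. by move=> Wf Wg; rewrite -!intertwiner_mul // mulrC. Qed.

(** The ratio identity for g and its image under E_{n+1,i}, cleared of lam_i^-1
    and lam'_i^-1. *)
Lemma intertwiner_lower g i : W a m g ->
  lam i *: (('X_i + a'%:MP) * (g * shift (- tuniti i) (phi g)))
  = lam' i *: (('X_i + a%:MP) * (shift (- tuniti i) g * phi g)).
Proof.
move=> Wg; set x := delta_mx ord_max (lift ord_max i) : 'M[F]_n.+1.
have trx : \tr x = 0 by apply: mxtrace_delta; rewrite neq_lift.
have := intertwiner_ratio (W_stable ha lam x Wg) Wg.
rewrite phi_sl // !Omega_sl_lower => E.
apply: (scalerI (mulf_neq0 (invr_neq0 (lam0 i)) (invr_neq0 (lam'0 i)))).
rewrite !scalerA [_ * lam i]mulrAC mulVf // mul1r.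
rewrite mulfVK // mulrCA scalerAr E -scalerAl mulrA //.
Qed.

(** The ratio identity for g and its image under E_{i,n+1}, translated by
    X_i -> X_i + 1 so that it involves the same two products as
    [intertwiner_lower]; the translation turns s - a into s + 1 - a. *)
Lemma intertwiner_raise g i : W a m g ->
  lam' i *: ((\sum_k 'X_k + (1 - a')%:MP) * (shift (- tuniti i) g * phi g))
  = lam i *: ((\sum_k 'X_k + (1 - a)%:MP) * (g * shift (- tuniti i) (phi g))).
Proof.
move=> Wg; set x := delta_mx (lift ord_max i) ord_max : 'M[F]_n.+1.
have trx : \tr x = 0.
  by apply: mxtrace_delta; rewrite eq_sym neq_lift.
have := intertwiner_ratio (W_stable ha lam x Wg) Wg.
rewrite phi_sl // !Omega_sl_raise !scaleNr mulrN mulNr => /oppr_inj.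
rewrite -scalerAr -scalerAl => /(congr1 (shift (- tuniti i))).
have shZ c p : shift (- tuniti i) (c *: p : Pn) = c *: shift (- tuniti i) p.
  by rewrite /shift comp_mpolyZ.
have shS c : shift (- tuniti i) (\sum_k 'X_k - c%:MP : Pn)
    = \sum_k 'X_k + (1 - c)%:MP.
  rewrite /shift rmorphB rmorph_sum /= -/(shift _ _) shiftC.
  under eq_bigr => k _ do rewrite -/(shift _ _) shiftX.
  rewrite sumrB [X in _ - X - _](bigD1 i) //= [X in _ - (_ + X) - _]big1 => [|k ki]; last first.
    by rewrite !mxE (negPf ki) oppr0 mpolyC0.
  by rewrite !mxE !eqxx addr0 mpolyCB mpolyCN opprK addrA.
rewrite !shZ !shiftM !shS !shiftA addNr !shift0 mulrCA => ->.
by rewrite mulrA.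
Qed.

Lemma intertwiner_rigid g : W a m g -> g != 0 -> phi g != 0 ->
  a = a' /\ forall i, lam i = lam' i.
Proof.
move=> Wg g0 pg0.
have nz i p : p != 0 -> shift (- tuniti i) p != 0 :> Pn by rewrite shift_eq0.
have aa' : a = a'.
  have [i [j ij]] : exists i j : 'I_n, i != j.
    by exists (Ordinal (ltnW n_gt1)), (Ordinal n_gt1).
  have lower := intertwiner_lower i Wg; have raise := intertwiner_raise i Wg.
  set u := g * _ in lower raise; set v := _ * phi g in lower raise.
  set s : Pn := \sum_k 'X_k in raise.
  have v0 : v != 0 by rewrite mulf_neq0 ?nz.
  have E : ('X_i + a'%:MP) * (s + (1 - a')%:MP)
      = ('X_i + a%:MP) * (s + (1 - a)%:MP).
    apply: (scalerI (lam'0 i)); apply: (mulIf v0); rewrite -!scalerAl.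
    rewrite -mulrA scalerAr raise -scalerAr mulrCA scalerAr lower.
    by rewrite -scalerAr mulrCA mulrA.
  (* Evaluating at the origin and at the j-th unit vector, where 'X_i still
     vanishes but s takes the value 1, separates the two parameters. *)
  have eval0 c : (('X_i + c%:MP) * (s + (1 - c)%:MP) : Pn).@[fun=> 0] = c * (1 - c).
    rewrite mevalM !mevalD mevalXU !mevalC add0r raddf_sum /= big1 ?add0r // => k _.
    exact: mevalXU.
  have evalj c : (('X_i + c%:MP) * (s + (1 - c)%:MP) : Pn).@[fun k => (k == j)%:R]
      = c * (1 + (1 - c)).
    rewrite mevalM !mevalD mevalXU !mevalC (negPf ij) add0r raddf_sum /=.
    rewrite (bigD1 j) //= mevalXU eqxx big1 ?addr0 // => k kj.
    by rewrite mevalXU (negPf kj).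
  have ceq (c : F) : c = c * (1 + (1 - c)) - c * (1 - c) by ring.
  by rewrite [a]ceq [a' in RHS]ceq -!evalj -!eval0 E.
(* With a = a' the factor 'X_i + a cancels, and both remaining products have
   leading coefficient mleadc g * mleadc (phi g). *)
split=> // i; have := intertwiner_lower i Wg; rewrite -aa'.
rewrite [LHS]scalerAr [RHS]scalerAr => /mulfI.
move=> /(_ (mpolyX_addC_neq0 i a)) /(congr1 (mcoeff (mlead g + mlead (phi g))%MM)).
rewrite !mcoeffZ mleadc_mul_shift [shift _ g * _]mulrC addmC mleadc_mul_shift mulrC.
rewrite [mleadc g * _]mulrC [RHS]mulrC; apply: mulfI.
by rewrite mulf_neq0 ?mleadc_eq0.
Qed.

End Intertwiner.

Lemma sl_iso_W_rigid :
  sl_iso (Omega_sl a lam) (W a m) (Omega_sl a' lam') (W a' m') ->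
  a = a' /\ forall i, lam i = lam' i.
Proof.
case=> phi [[_ phi_inj _] phi_lin phi_sl].
have [g Wg g0] := W_neq0 a m (Ordinal n_gt1).
apply: (intertwiner_rigid phi_lin phi_sl Wg g0).
have phi0 : phi 0 = 0.
  by have := phi_lin (-1) _ _ Wg Wg; rewrite !scaleN1r !addNr.
apply: contra_neq g0 => pg0; apply: phi_inj; rewrite ?inE ?phi0 //.
exact: W0.
Qed.

End Rigidity.

Unset Implicit Arguments.

Theorem corollary19 (R : realType) (n : nat) (hn : (2 <= n)%N)
  (lam lam' : 'I_n -> complex R)
  (hlam : forall i : 'I_n, lam i != 0) (hlam' : forall i : 'I_n, lam' i != 0)
  (m m' : nat) (a a' : complex R)
  (ha : a = - (m%:R / n.+1%:R)) (ha' : a' = - (m'%:R / n.+1%:R)) :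
  sl_iso (Omega_sl a lam) (W a m)
         (Omega_sl a' lam') (W a' m')
  <-> a = a' /\ (forall i : 'I_n, lam i = lam' i).
Proof.
have n1 : n.+1%:R != 0 :> complex R by rewrite Num.Theory.pnatr_eq0.
split=> [|[aa' /funext <-]].
  by apply: sl_iso_W_rigid => //; rewrite ha mulrN mulrC divfK.
(* The characteristic is zero, so m can be read off a. *)
have mm' : m = m'.
  move: aa'; rewrite ha ha' => /oppr_inj /(divIf n1) /eqP.
  by rewrite Num.Theory.eqr_nat => /eqP.
rewrite -aa' -mm'; exists id; split=> //.
by split=> // f Wf; exists f.
Qed.
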